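(* Let $T$ be a consistent recursively enumerable theory with $T\supseteq\mathsf{Q}$. Suppose that for every formula $\psi$ we have $T\vdash\mathsf{Pr}_T(\bot)\rightarrow\mathsf{Pr}_T(\psi)$. If $T+\mathsf{Con}(T)$ is inconsistent, then for every $b\in\mathbb{N}$ we have $T\vdash\mathsf{Def}_T^{<\overline{5}\cdot\overline{\ell_T}}(\overline{b})$, and hence $T\vdash\neg\mathsf{Boolos}_T(\overline{b})$.
   Context: Formulas of arithmetic are Gödel-coded in a standard way. Variables are $x,x',x'',\dots$, of lengths $1,2,3,\dots$. The length of a formula (or of its code) is denoted $\mathsf{len}$. The numeral $\overline{m}$ is $\mathsf{s}(\cdots\mathsf{s}(0)\cdots)$, with $m$ occurrences of $\mathsf{s}$. $\mathsf{Pr}_T(x)$ is the standard provability predicate of $T$, and $\mathsf{Con}(T)=\neg\mathsf{Pr}_T(\bot)$. For a formula $\psi(x_1,\dots,x_m)$ and a number $n$, ${\sf D}(\psi,n)$ is the Gödel code of $\forall x[\psi(x,\dots,x)\leftrightarrow x=\overline{n}]$; this is formalized as a function ${\sf D}(x,y)$ in arithmetic. Define the following formulas: - $\mathsf{Def}_T^{<z}(y)$ is $\exists x[\mathsf{len}(x)<z\wedge\mathsf{Pr}_T({\sf D}(x,y))]$. - $\mathsf{Berry}_T^{<v}(u)$ is $\neg\mathsf{Def}_T^{<v}(u)\wedge\forall y<u\,\mathsf{Def}_T^{<v}(y)$. - $\mathsf{Boolos}_T(x)$ is $\exists x'[x'=\overline{5}\cdot\overline{\ell_T}\wedge\mathsf{Berry}_T^{<x'}(x)]$,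 where $\ell_T$ is the length of the formula $\mathsf{Berry}_T^{<x'}(x)$. $\mathsf{Q}$ is Robinson's arithmetic. *)

(* Defs.v *)
From mathcomp Require Import all_boot.

Set Implicit Arguments.
Unset Strict Implicit.
Unset Printing Implicit Defensive.

(** [Var i] is the variable x with [i] primes. *)
Inductive term : Type :=
| Var of nat
| Zero
| Succ of term
| Add of term & term
| Mul of term & term.

Inductive form : Type :=
| Bot
| Eq of term & term
| Imp of form & form
| All of nat & form.

Definition Neg A := Imp A Bot.
Definition And A B := Neg (Imp A (Neg B)).
Definition Or A B := Imp (Neg A) B.
Definition Iff A B := And (Imp A B) (Imp B A).
Definition Ex i A := Neg (All i (Neg A)).

Fixpoint num (n : nat) : term := if n is m.+1 then Succ (num m) else Zero.

(** Length is the number of symbols in prefix notation, where x with [i] primes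
    counts for [i.+1] symbols. *)
Fixpoint tlen (t : term) : nat :=
  match t with
  | Var i => i.+1
  | Zero => 1
  | Succ u => (tlen u).+1
  | Add u v | Mul u v => (tlen u + tlen v).+1
  end.

Fixpoint len (A : form) : nat :=
  match A with
  | Bot => 1
  | Eq t u => (tlen t + tlen u).+1
  | Imp B C => (len B + len C).+1
  | All i B => (i.+1 + len B).+1
  end.

Fixpoint occurs (i : nat) (t : term) : bool :=
  match t with
  | Var j => i == j
  | Zero => false
  | Succ u => occurs i u
  | Add u v | Mul u v => occurs i u || occurs i v
  end.

Fixpoint free (i : nat) (A : form) : bool :=
  match A with
  | Bot => false
  | Eq t u => occurs i t || occurs i u
  | Imp B C => free i B || free i C
  | All j B => (i != j) && free i B
  end.

Definition sentence (A : form) : Prop := forall i, ~~ free i A.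

Fixpoint tsubst (i : nat) (s t : term) : term :=
  match t with
  | Var j => if i == j then s else t
  | Zero => Zero
  | Succ u => Succ (tsubst i s u)
  | Add u v => Add (tsubst i s u) (tsubst i s v)
  | Mul u v => Mul (tsubst i s u) (tsubst i s v)
  end.

(** Naive substitution; it is only used under [free_for]. *)
Fixpoint subst (i : nat) (s : term) (A : form) : form :=
  match A with
  | Bot => Bot
  | Eq t u => Eq (tsubst i s t) (tsubst i s u)
  | Imp B C => Imp (subst i s B) (subst i s C)
  | All j B => if i == j then A else All j (subst i s B)
  end.

Fixpoint free_for (i : nat) (s : term) (A : form) : bool :=
  match A with
  | Bot | Eq _ _ => true
  | Imp B C => free_for i s B && free_for i s C
  | All j B =>
      (i == j) || free_for i s B && (~~ occurs j s || ~~ free i B)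
  end.

Inductive proves (T : form -> Prop) : form -> Prop :=
| pr_ax A : T A -> proves T A
| pr_mp A B : proves T (Imp A B) -> proves T A -> proves T B
| pr_gen i A : proves T A -> proves T (All i A)
| pr_k A B : proves T (Imp A (Imp B A))
| pr_s A B C :
    proves T (Imp (Imp A (Imp B C)) (Imp (Imp A B) (Imp A C)))
| pr_dn A : proves T (Imp (Neg (Neg A)) A)
| pr_inst i t A :
    free_for i t A -> proves T (Imp (All i A) (subst i t A))
| pr_dist i A B :
    ~~ free i A -> proves T (Imp (All i (Imp A B)) (Imp A (All i B)))
| pr_refl t : proves T (Eq t t)
| pr_eucl t u v : proves T (Imp (Eq t u) (Imp (Eq t v) (Eq u v)))
| pr_succ t u : proves T (Imp (Eq t u) (Eq (Succ t) (Succ u)))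
| pr_add t u t' u' :
    proves T (Imp (Eq t t') (Imp (Eq u u') (Eq (Add t u) (Add t' u'))))
| pr_mul t u t' u' :
    proves T (Imp (Eq t t') (Imp (Eq u u') (Eq (Mul t u) (Mul t' u')))).

Definition consistent (T : form -> Prop) : Prop := ~ proves T Bot.

Definition extend (T : form -> Prop) (A : form) : form -> Prop :=
  fun B => T B \/ B = A.

Notation x0 := (Var 0) (only parsing).
Notation x1 := (Var 1) (only parsing).
Notation x2 := (Var 2) (only parsing).

Inductive Q : form -> Prop :=
| Q1 : Q (All 0 (Neg (Eq (Succ x0) Zero)))
| Q2 : Q (All 0 (All 1 (Imp (Eq (Succ x0) (Succ x1)) (Eq x0 x1))))
| Q3 : Q (All 0 (Or (Eq x0 Zero) (Ex 1 (Eq x0 (Succ x1)))))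
| Q4 : Q (All 0 (Eq (Add x0 Zero) x0))
| Q5 : Q (All 0 (All 1 (Eq (Add x0 (Succ x1)) (Succ (Add x0 x1)))))
| Q6 : Q (All 0 (Eq (Mul x0 Zero) Zero))
| Q7 : Q (All 0 (All 1 (Eq (Mul x0 (Succ x1)) (Add (Mul x0 x1) x0)))).

Definition extends (T S : form -> Prop) : Prop := forall A, S A -> proves T A.

(** An injective pairing whose value is never 0. *)
Definition op (a b : nat) : nat := ((a + b) * (a + b) + a).+1.

Fixpoint tcode (t : term) : nat :=
  match t with
  | Var i => op 0 i
  | Zero => op 1 0
  | Succ u => op 2 (tcode u)
  | Add u v => op 3 (op (tcode u) (tcode v))
  | Mul u v => op 4 (op (tcode u) (tcode v))
  end.

Fixpoint code (A : form) : nat :=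
  match A with
  | Bot => op 5 0
  | Eq t u => op 6 (op (tcode t) (tcode u))
  | Imp B C => op 7 (op (code B) (code C))
  | All i B => op 8 (op i (code B))
  end.

Definition codes (T : form -> Prop) (n : nat) : Prop :=
  exists2 A, T A & code A = n.

(** [collapse (len A) [::] A] is A(x,...,x): the variable x is substituted for
    every free variable of [A], and to avoid capture a bound x is renamed to the
    variable of index [len A], which does not occur in [A]. The list [G] holds
    the variables bound so far. *)
Definition rename (f i : nat) : nat := if i == 0 then f else i.

Fixpoint tcollapse (f : nat) (G : seq nat) (t : term) : term :=
  match t with
  | Var i => Var (if i \in G then rename f i else 0)
  | Zero => Zero
  | Succ u => Succ (tcollapse f G u)
  | Add u v => Add (tcollapse f G u) (tcollapse f G v)
  | Mul u v => Mul (tcollapse f G u) (tcollapse f G v)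
  end.

Fixpoint collapse (f : nat) (G : seq nat) (A : form) : form :=
  match A with
  | Bot => Bot
  | Eq t u => Eq (tcollapse f G t) (tcollapse f G u)
  | Imp B C => Imp (collapse f G B) (collapse f G C)
  | All i B => All (rename f i) (collapse f (i :: G) B)
  end.

(** The sentence whose code is D(A,n). *)
Definition diag (A : form) (n : nat) : form :=
  All 0 (Iff (collapse (len A) [::] A) (Eq x0 (num n))).

Inductive recf : Type :=
| RZero
| RSucc
| RProj of nat
| RComp of recf & seq recf
| RRec of recf & recf
| RMin of recf.

Inductive computes : recf -> seq nat -> nat -> Prop :=
| c_zero xs : computes RZero xs 0
| c_succ x xs : computes RSucc (x :: xs) x.+1
| c_proj k xs : k < size xs -> computes (RProj k) xs (nth 0 xs k)
| c_comp f gs xs ys z :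
    computes_all gs xs ys -> computes f ys z -> computes (RComp f gs) xs z
| c_rec0 f g xs z : computes f xs z -> computes (RRec f g) (0 :: xs) z
| c_recS f g n xs y z :
    computes (RRec f g) (n :: xs) y -> computes g (n :: y :: xs) z ->
    computes (RRec f g) (n.+1 :: xs) z
| c_min f n xs :
    computes f (n :: xs) 0 ->
    (forall m, m < n -> exists y, computes f (m :: xs) y.+1) ->
    computes (RMin f) xs n
with computes_all : seq recf -> seq nat -> seq nat -> Prop :=
| c_nil xs : computes_all [::] xs [::]
| c_cons g gs xs y ys :
    computes g xs y -> computes_all gs xs ys ->
    computes_all (g :: gs) xs (y :: ys).

Definition recursively_enumerable (S : nat -> Prop) : Prop :=
  exists f, forall n, S n <-> exists v, computes f [:: n] v.

Fixpoint eval (e : nat -> nat) (t : term) : nat :=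
  match t with
  | Var i => e i
  | Zero => 0
  | Succ u => (eval e u).+1
  | Add u v => eval e u + eval e v
  | Mul u v => eval e u * eval e v
  end.

Definition upd (e : nat -> nat) (i n : nat) : nat -> nat :=
  fun j => if j == i then n else e j.

Fixpoint sat (e : nat -> nat) (A : form) : Prop :=
  match A with
  | Bot => False
  | Eq t u => eval e t = eval e u
  | Imp B C => sat e B -> sat e C
  | All i B => forall n, sat (upd e i n) B
  end.

Inductive Delta0 : form -> Prop :=
| D0_bot : Delta0 Bot
| D0_eq t u : Delta0 (Eq t u)
| D0_le z t u :
    ~~ occurs z t -> ~~ occurs z u -> Delta0 (Ex z (Eq (Add (Var z) t) u))
| D0_imp A B : Delta0 A -> Delta0 B -> Delta0 (Imp A B)
| D0_all i z t A :
    z != i -> ~~ occurs i t -> ~~ occurs z t -> Delta0 A ->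
    Delta0 (All i (Imp (Ex z (Eq (Add (Var z) (Var i)) t)) A)).

(** [delta] is a Delta_0 formula with x' ranging over witnesses, so that
    ∃x' [delta] is a Sigma_1 definition of the set of axioms of [T]. *)
Definition presents (delta : form) (T : form -> Prop) : Prop :=
  [/\ Delta0 delta,
      (forall i, free i delta -> i < 2) &
      forall c, codes T c <->
        exists v, sat (fun i => if i == 0 then c else v) delta].

(** An [lform] yields a formula given a level [n] that bounds the indices of
    all variables in use; binders take the variables x_n, x_(n+1), ... *)
Definition lform := nat -> form.

Declare Scope arith_scope.
Delimit Scope arith_scope with arith.
Bind Scope arith_scope with lform.

Definition aneg (A : lform) : lform := fun n => Neg (A n).
Definition aand (A B : lform) : lform := fun n => And (A n) (B n).
Definition aor (A B : lform) : lform := fun n => Or (A n) (B n).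
Definition aimp (A B : lform) : lform := fun n => Imp (A n) (B n).
Definition aeq (t u : term) : lform := fun _ => Eq t u.
Definition aex (F : term -> lform) : lform := fun n => Ex n (F (Var n) n.+1).
Definition aall (F : term -> lform) : lform := fun n => All n (F (Var n) n.+1).

Notation "~ A" := (aneg A) : arith_scope.
Notation "A /\ B" := (aand A%arith B%arith) : arith_scope.
Notation "A \/ B" := (aor A%arith B%arith) : arith_scope.
Notation "A -> B" := (aimp A%arith B%arith) : arith_scope.
Notation "t = u" := (aeq t u) : arith_scope.
Notation "∃ x .. y , F" := (aex (fun x => .. (aex (fun y => F%arith)) ..))
  (at level 200, x binder, y binder, right associativity) : arith_scope.

Definition ale (t u : term) : lform := (∃ z, Add z t = u)%arith.
Definition alt (t u : term) : lform := ale (Succ t) u.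
Notation "t <= u" := (ale t u) : arith_scope.
Notation "t < u" := (alt t u) : arith_scope.

Definition aexle (b : term) (F : term -> lform) : lform :=
  (∃ x, x <= b /\ F x)%arith.
Definition aallle (b : term) (F : term -> lform) : lform :=
  aall (fun x => (x <= b -> F x)%arith).
Notation "∃ x .. y ≤ b , F" :=
  (aexle b (fun x => .. (aexle b (fun y => F%arith)) ..))
  (at level 200, x binder, y binder, right associativity) : arith_scope.
Notation "∀ x ≤ b , F" := (aallle b (fun x => F%arith))
  (at level 200, x binder, right associativity) : arith_scope.

Local Open Scope arith_scope.

(** Gödel's beta function: [x] is the remainder of [b] modulo 1 + (i+1)a. *)
Definition beta (b a i x : term) : lform :=
  let m := Succ (Mul (Succ i) a) in
  x < m /\ ∃ q ≤ b, Add (Mul q m) x = b.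

(** [trace R x]: there is a finite sequence with last entry [x], each of whose
    entries satisfies the rule [R], which may refer to strictly earlier entries
    through its predicate argument. All values and components of values are
    bounded by the parameter [b], which is the first argument of [R]. *)
Definition rule : Type := (term -> (term -> lform) -> term -> lform)%type.

Definition trace (R : rule) (x : term) : lform :=
  ∃ b a k, beta b a k x /\
    ∀ i ≤ k, ∃ y ≤ b, beta b a i y /\
      R b (fun z => ∃ j ≤ i, j < i /\ beta b a j z) y.

Definition pair (a b : term) : term :=
  Succ (Add (Mul (Add a b) (Add a b)) a).

Definition qvar i := pair (num 0) i.
Definition qzero := pair (num 1) (num 0).
Definition qsucc t := pair (num 2) t.
Definition qadd t u := pair (num 3) (pair t u).
Definition qmul t u := pair (num 4) (pair t u).
Definition qbot := pair (num 5) (num 0).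
Definition qeq t u := pair (num 6) (pair t u).
Definition qimp A B := pair (num 7) (pair A B).
Definition qall i A := pair (num 8) (pair i A).
Definition qneg A := qimp A qbot.
Definition qiff A B := qneg (qimp (qimp A B) (qneg (qimp B A))).

(** The judgements derived by traces:
    - [jterm t l], [jform A l]: a term, resp. formula, of length [l];
    - [jnotfree i c]: x_i does not occur free in the term or formula [c];
    - [jsubst i s c d]: [s] is free for x_i in [c], and [d] is [c] with [s]
      substituted for x_i;
    - [jnum n c]: the numeral of [n];
    - [jlookup f G i k], [jcollapse f G c d]: as in [collapse], with
      [k] the index of the variable which replaces x_i;
    - [jprov A]: provability. *)
Definition jterm t l := pair (num 0) (pair t l).
Definition jform A l := pair (num 1) (pair A l).
Definition jnotfree i c := pair (num 2) (pair i c).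
Definition jsubst i s c d := pair (num 3) (pair (pair i s) (pair c d)).
Definition jnum n c := pair (num 4) (pair n c).
Definition jlookup f G i k := pair (num 5) (pair (pair f G) (pair i k)).
Definition jcollapse f G c d := pair (num 6) (pair (pair f G) (pair c d)).
Definition jprov A := pair (num 7) A.

Definition anyof (s : seq lform) : lform := foldr aor (fun _ => Bot) s.

(** The codes of [Add], [Mul], [Eq] and [Imp] are built alike, as are those
    of the leaves [Zero] and [Bot]. *)
Definition qbinary : seq (term -> term -> term) := [:: qadd; qmul; qeq; qimp].
Definition qleaves : seq term := [:: qzero; qbot].

Definition len_rule : rule := fun b prev y => anyof
  ([:: ∃ i ≤ b, y = jterm (qvar i) (Succ i);
       y = jterm qzero (num 1);
       ∃ t l ≤ b, prev (jterm t l) /\ y = jterm (qsucc t) (Succ l)]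
   ++ [seq ∃ t l u m ≤ b, prev (jterm t l) /\ prev (jterm u m) /\
           y = jterm (q t u) (Succ (Add l m)) | q <- [:: qadd; qmul]]
   ++ [:: y = jform qbot (num 1);
       ∃ t l u m ≤ b, prev (jterm t l) /\ prev (jterm u m) /\
         y = jform (qeq t u) (Succ (Add l m));
       ∃ A l B m ≤ b, prev (jform A l) /\ prev (jform B m) /\
         y = jform (qimp A B) (Succ (Add l m));
       ∃ i A l ≤ b, prev (jform A l) /\
         y = jform (qall i A) (Succ (Add (Succ i) l))]).

Definition notfree_rule : rule := fun b prev y => anyof
  ([:: ∃ i j ≤ b, ~ (i = j) /\ y = jnotfree i (qvar j);
       ∃ i t ≤ b, prev (jnotfree i t) /\ y = jnotfree i (qsucc t);
       ∃ i j A ≤ b, (i = j \/ prev (jnotfree i A)) /\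
         y = jnotfree i (qall j A)]
   ++ [seq ∃ i ≤ b, y = jnotfree i q | q <- qleaves]
   ++ [seq ∃ i c d ≤ b, prev (jnotfree i c) /\ prev (jnotfree i d) /\
           y = jnotfree i (q c d) | q <- qbinary]).

Definition subst_rule : rule := fun b prev y => anyof
  ([:: ∃ i s ≤ b, y = jsubst i s (qvar i) s;
       ∃ i s j ≤ b, ~ (i = j) /\ y = jsubst i s (qvar j) (qvar j);
       ∃ i s t t' ≤ b, prev (jsubst i s t t') /\
         y = jsubst i s (qsucc t) (qsucc t');
       ∃ i s A ≤ b, y = jsubst i s (qall i A) (qall i A);
       ∃ i s j A A' ≤ b, ~ (i = j) /\ prev (jsubst i s A A') /\
         (prev (jnotfree j s) \/ prev (jnotfree i A)) /\
         y = jsubst i s (qall j A) (qall j A')]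
   ++ [seq ∃ i s ≤ b, y = jsubst i s q q | q <- qleaves]
   ++ [seq ∃ i s c c' d d' ≤ b,
           prev (jsubst i s c c') /\ prev (jsubst i s d d') /\
           y = jsubst i s (q c d) (q c' d') | q <- qbinary]).

Definition num_rule : rule := fun b prev y => anyof
  [:: y = jnum Zero qzero;
      ∃ n c ≤ b, prev (jnum n c) /\ y = jnum (Succ n) (qsucc c)].

Definition arename (f i k : term) : lform :=
  (i = Zero /\ k = f) \/ (~ (i = Zero) /\ k = i).

(** The list [G] is coded with 0 for the empty list and [pair] for cons. *)
Definition collapse_rule : rule := fun b prev y => anyof
  ([:: ∃ f i ≤ b, y = jlookup f Zero i Zero;
       ∃ f G i k ≤ b, arename f i k /\ y = jlookup f (pair i G) i k;
       ∃ f G i j k ≤ b, ~ (i = j) /\ prev (jlookup f G i k) /\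
         y = jlookup f (pair j G) i k;
       ∃ f G i k ≤ b, prev (jlookup f G i k) /\
         y = jcollapse f G (qvar i) (qvar k);
       ∃ f G t t' ≤ b, prev (jcollapse f G t t') /\
         y = jcollapse f G (qsucc t) (qsucc t');
       ∃ f G i k A A' ≤ b, arename f i k /\
         prev (jcollapse f (pair i G) A A') /\
         y = jcollapse f G (qall i A) (qall k A')]
   ++ [seq ∃ f G ≤ b, y = jcollapse f G q q | q <- qleaves]
   ++ [seq ∃ f G c c' d d' ≤ b,
           prev (jcollapse f G c c') /\ prev (jcollapse f G d d') /\
           y = jcollapse f G (q c d) (q c' d') | q <- qbinary]).

(** [delta] is an arbitrary formula, so its arguments are passed by equations
    rather than by substitution; this is correct for terms [c] and [w] that do
    not contain x and x'. The variable [w] bounds the witnesses. *)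
Definition axiom_at (delta : form) (w c : term) : lform :=
  fun n => Ex 0 (And (Eq x0 c) (Ex 1 (And ((x1 <= w) n) delta))).

Definition proof_rule (delta : form) (w : term) : rule := fun b prev y =>
  let isterm t := ∃ l ≤ b, prev (jterm t l) in
  let isform A := ∃ l ≤ b, prev (jform A l) in
  ∃ c ≤ b, y = jprov c /\ anyof
    [:: axiom_at delta w c;
        ∃ A ≤ b, prev (jprov (qimp A c)) /\ prev (jprov A);
        ∃ i A ≤ b, prev (jprov A) /\ c = qall i A;
        ∃ A B ≤ b, isform A /\ isform B /\ c = qimp A (qimp B A);
        ∃ A B C ≤ b, isform A /\ isform B /\ isform C /\
          c = qimp (qimp A (qimp B C)) (qimp (qimp A B) (qimp A C));
        ∃ A ≤ b, isform A /\ c = qimp (qneg (qneg A)) A;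
        ∃ i t A A' ≤ b, isterm t /\ isform A /\ prev (jsubst i t A A') /\
          c = qimp (qall i A) A';
        ∃ i A B ≤ b, isform A /\ isform B /\ prev (jnotfree i A) /\
          c = qimp (qall i (qimp A B)) (qimp A (qall i B));
        ∃ t ≤ b, isterm t /\ c = qeq t t;
        ∃ t u v ≤ b, isterm t /\ isterm u /\ isterm v /\
          c = qimp (qeq t u) (qimp (qeq t v) (qeq u v));
        ∃ t u ≤ b, isterm t /\ isterm u /\
          c = qimp (qeq t u) (qeq (qsucc t) (qsucc u));
        ∃ t u t' u' ≤ b, isterm t /\ isterm u /\ isterm t' /\ isterm u' /\
          c = qimp (qeq t t') (qimp (qeq u u') (qeq (qadd t u) (qadd t' u')));
        ∃ t u t' u' ≤ b, isterm t /\ isterm u /\ isterm t' /\ isterm u' /\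
          c = qimp (qeq t t') (qimp (qeq u u') (qeq (qmul t u) (qmul t' u')))].

Definition provable_rule (delta : form) (w : term) : rule := fun b prev y =>
  anyof [:: len_rule b prev y; notfree_rule b prev y; subst_rule b prev y;
            proof_rule delta w b prev y].

Definition alen (x l : term) : lform := trace len_rule (jform x l).

Definition aD (x y z : term) : lform :=
  ∃ f p c, alen x f /\ trace collapse_rule (jcollapse f Zero x p) /\
    trace num_rule (jnum y c) /\
    z = qall (num 0) (qiff p (qeq (qvar (num 0)) c)).

(** The provability predicate is that of the theory presented by [delta]: its
    [proof_rule] mirrors [proves] clause by clause. *)
Definition aPr (delta : form) (x : term) : lform :=
  ∃ w, trace (provable_rule delta w) (jprov x).

Definition aDef (delta : form) (z y : term) : lform :=
  ∃ x, (∃ l, alen x l /\ l < z) /\ (∃ d, aD x y d /\ aPr delta d).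

(** The levels below are such that the arguments may be closed terms or involve
    x, x', x'' (in [Pr] also the next two variables): the bound variables are
    further ones, except in [axiom_at], which no argument reaches. Hence putting
    a term for an argument is capture-free substitution. *)
Definition Pr (delta : form) (x : term) : form := aPr delta x 5.

Definition Con (delta : form) : form := Neg (Pr delta (num (code Bot))).

Definition Def (delta : form) (z y : term) : form := aDef delta z y 3.

(** The arguments are to be closed or among x, x'. *)
Definition Berry (delta : form) (v u : term) : form :=
  And (Neg (Def delta v u)) (All 2 (Imp ((x2 < u) 3) (Def delta v x2))).

Definition ell (delta : form) : nat := len (Berry delta x1 x0).

(** The argument is to be closed or x. *)
Definition Boolos (delta : form) (x : term) : form :=
  Ex 1 (And (Eq x1 (Mul (num 5) (num (ell delta)))) (Berry delta x1 x)).

(* Main.v *)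
Require Import Defs.
From mathcomp Require Import all_boot zify.

(** As T + Con(T) is inconsistent, T proves Pr(⊥), hence by hypothesis Pr(A) for
    every formula A, in particular for A = D(⊥, b). So T believes that the
    formula ⊥, of length 1, defines b. What remains is that T proves the true
    statements "⊥ has length 1" and "D(⊥, b) is the code of A". These are
    Sigma_1, and Q proves them once the derivations that witness them are coded
    by Gödel's beta function. *)

Set Implicit Arguments.
Unset Strict Implicit.
Unset Printing Implicit Defensive.

(** * Substitution *)

Definition closed_term (t : term) : Prop := forall i, ~~ occurs i t.

Lemma closed_num n : closed_term (num n).
Proof. by move=> i; elim: n. Qed.

Lemma closed_mul t u : closed_term t -> closed_term u -> closed_term (Mul t u).
Proof. by move=> ct cu i; rewrite /= negb_or ct cu. Qed.

Lemma sentence_neg A : sentence A -> sentence (Neg A).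
Proof. by move=> sA i; rewrite /= orbF sA. Qed.

Lemma tsubst_id i s t : ~~ occurs i t -> tsubst i s t = t.
Proof.
elim: t => //= [j|t IHt|t IHt u IHu|t IHt u IHu].
- by case: ifP.
- by move/IHt->.
- by rewrite negb_or => /andP[/IHt-> /IHu->].
- by rewrite negb_or => /andP[/IHt-> /IHu->].
Qed.

Lemma tsubst_num i s n : tsubst i s (num n) = num n.
Proof. exact/tsubst_id/closed_num. Qed.

Lemma subst_id i s A : ~~ free i A -> subst i s A = A.
Proof.
elim: A => //= [t u|A IHA B IHB|j A IHA].
- by rewrite negb_or => /andP[nt nu]; rewrite !tsubst_id.
- by rewrite negb_or => /andP[/IHA-> /IHB->].
- by case: eqP => //= _ /IHA->.
Qed.

Lemma free_for_var i A : free_for i (Var i) A.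
Proof.
elim: A => //= [A -> B ->|j A ->] //.
by rewrite (eq_sym j); case: (i == j).
Qed.

Lemma tsubst_var i t : tsubst i (Var i) t = t.
Proof.
by elim: t => //= [j|t ->|t -> u ->|t -> u ->] //; case: eqP => // ->.
Qed.

Lemma subst_var i A : subst i (Var i) A = A.
Proof.
elim: A => //= [t u|A -> B ->|j A ->] //; first by rewrite !tsubst_var.
by case: ifP.
Qed.

Lemma free_for_closed i s A : closed_term s -> free_for i s A.
Proof.
move=> cs; elim: A => //= [A -> B ->|j A ->] //.
by rewrite cs orbT.
Qed.

Lemma occurs_tsubst i j s t :
  closed_term s -> occurs i (tsubst j s t) -> (i != j) && occurs i t.
Proof.
move=> cs; elim: t => //= [k|t IHt u IHu|t IHt u IHu].
- case: (j =P k) => [_|jk] /=; first by rewrite (negbTE (cs i)).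
  by move/eqP->; rewrite eqxx andbT; apply/eqP => kj; case: jk.
- by case/orP => [/IHt|/IHu] /andP[-> ->]; rewrite ?orbT.
- by case/orP => [/IHt|/IHu] /andP[-> ->]; rewrite ?orbT.
Qed.

Lemma free_subst i j s A :
  closed_term s -> free i (subst j s A) -> (i != j) && free i A.
Proof.
move=> cs; elim: A => //= [t u|A IHA B IHB|k A IHA].
- by case/orP => /(occurs_tsubst cs)/andP[-> ->]; rewrite ?orbT.
- by case/orP => [/IHA|/IHB] /andP[-> ->]; rewrite ?orbT.
- case: (j =P k) => [->|_] /=.
    by case/andP => -> ->.
  by case/andP => -> /IHA/andP[-> ->].
Qed.

(** * Natural deduction *)

(** The head of [G] becomes the innermost antecedent, so that introducing an
    implication is a conversion. *)
Fixpoint nd (T : form -> Prop) (G : seq form) (A : form) : Prop :=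
  if G is H :: G' then nd T G' (Imp H A) else proves T A.

Notation "G ⊢[ T ] A" := (nd T G A) (at level 70, A at next level).
Arguments nd : simpl never.

Section NaturalDeduction.

Context (T : form -> Prop).
Implicit Types (A B C : form) (G : seq form).

Lemma nd_proves G A : proves T A -> G ⊢[T] A.
Proof.
by elim: G A => //= H G IH A TA; apply: IH; apply: pr_mp (pr_k _ _ _) TA.
Qed.

Lemma nd_imp G A B : A :: G ⊢[T] B -> G ⊢[T] Imp A B.
Proof. by []. Qed.

Lemma nd_mp G A B : G ⊢[T] Imp A B -> G ⊢[T] A -> G ⊢[T] B.
Proof.
elim: G A B => /= [|H G IH] A B; first exact: pr_mp.
move=> HAB HA; apply: (IH _ _ _ HA); apply: (IH _ _ _ HAB).
exact/nd_proves/pr_s.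
Qed.

Lemma nd_weak H G A : G ⊢[T] A -> H :: G ⊢[T] A.
Proof. by move=> GA /=; apply: nd_mp GA; apply/nd_proves/pr_k. Qed.

Lemma nd_hd A G : A :: G ⊢[T] A.
Proof.
apply: (@nd_proves G (Imp A A)).
exact: pr_mp (pr_mp (pr_s T A (Imp A A) A) (pr_k T A (Imp A A))) (pr_k T A A).
Qed.

Lemma nd_botE G A : G ⊢[T] Bot -> G ⊢[T] A.
Proof.
move=> GB; apply: nd_mp (nd_proves _ (pr_dn _ A)) _.
by apply: (nd_weak (Neg A)).
Qed.

Lemma nd_cases G A B :
  A :: G ⊢[T] B -> Neg A :: G ⊢[T] B -> G ⊢[T] B.
Proof.
move=> AB nAB; apply: nd_mp (nd_proves _ (pr_dn _ B)) _.
change (Neg B :: G ⊢[T] Bot).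
have AB' : Neg B :: G ⊢[T] Imp A B by apply: nd_weak (nd_imp AB).
have nAB' : Neg B :: G ⊢[T] Imp (Neg A) B by apply: nd_weak (nd_imp nAB).
apply: nd_mp (nd_hd _ _) _; apply: nd_mp nAB' _.
change (A :: Neg B :: G ⊢[T] Bot).
apply: (nd_mp (A := B)); first exact: nd_weak (nd_hd _ _).
exact: nd_mp (nd_weak _ AB') (nd_hd _ _).
Qed.

Lemma nd_or_elim G A B C :
  G ⊢[T] Or A B -> A :: G ⊢[T] C -> B :: G ⊢[T] C -> G ⊢[T] C.
Proof.
move=> GAB HA HB; apply: (nd_cases HA).
apply: (nd_mp (A := B)); first exact: nd_weak (nd_imp HB).
exact: (nd_mp (nd_weak _ GAB) (nd_hd _ _)).
Qed.

Lemma nd_or_introl G A B : G ⊢[T] A -> G ⊢[T] Or A B.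
Proof.
move=> GA; change (Neg A :: G ⊢[T] B).
by apply: nd_botE; apply: nd_mp (nd_hd _ _) (nd_weak _ GA).
Qed.

Lemma nd_or_intror G A B : G ⊢[T] B -> G ⊢[T] Or A B.
Proof. exact: nd_weak. Qed.

Lemma nd_and_intro G A B : G ⊢[T] A -> G ⊢[T] B -> G ⊢[T] And A B.
Proof.
move=> GA GB; change (Imp A (Neg B) :: G ⊢[T] Bot).
apply: nd_mp (nd_weak _ GB).
by apply: (@nd_mp _ A) (nd_weak _ GA); apply: nd_hd.
Qed.

Lemma nd_andl G A B : G ⊢[T] And A B -> G ⊢[T] A.
Proof.
move=> GAB; apply: nd_mp (nd_proves _ (pr_dn _ A)) _.
change (Neg A :: G ⊢[T] Bot).
apply: nd_mp (nd_weak _ GAB) _.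
change (A :: Neg A :: G ⊢[T] Neg B); apply: nd_botE.
by apply: nd_mp (nd_hd _ _); apply: nd_weak; apply: nd_hd.
Qed.

Lemma nd_andr G A B : G ⊢[T] And A B -> G ⊢[T] B.
Proof.
move=> GAB; apply: nd_mp (nd_proves _ (pr_dn _ B)) _.
change (Neg B :: G ⊢[T] Bot).
by apply: nd_mp (nd_weak _ GAB) _; apply: nd_weak (nd_hd _ _).
Qed.

Lemma nd_inst G i t A :
  free_for i t A -> G ⊢[T] All i A -> G ⊢[T] subst i t A.
Proof. by move=> fA; apply: nd_mp; apply/nd_proves/pr_inst. Qed.

Lemma nd_gen G i A :
  all (fun H => ~~ free i H) G -> G ⊢[T] A -> G ⊢[T] All i A.
Proof.
elim: G A => /= [|H G IH] A; first by move=> _; apply: pr_gen.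
by case/andP=> nH nG /(IH _ nG); apply: nd_mp; apply/nd_proves/pr_dist.
Qed.

Lemma nd_ex_elim G i A C :
  all (fun H => ~~ free i H) (C :: G) ->
  G ⊢[T] Ex i A -> A :: G ⊢[T] C -> G ⊢[T] C.
Proof.
case/andP=> nC nG GA HA; apply: nd_mp (nd_proves _ (pr_dn _ C)) _.
change (Neg C :: G ⊢[T] Bot).
apply: nd_mp (nd_weak _ GA) _; apply: nd_gen; first by rewrite /= orbF nC.
change (A :: Neg C :: G ⊢[T] Bot).
apply: (@nd_mp _ C); first exact: nd_weak (nd_hd _ _).
exact: nd_weak (nd_imp HA).
Qed.

Lemma nd_ex_intro G i t A :
  free_for i t A -> G ⊢[T] subst i t A -> G ⊢[T] Ex i A.
Proof.
move=> fA GA; change (All i (Neg A) :: G ⊢[T] Bot).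
apply: (@nd_mp _ (subst i t A)); last exact: nd_weak.
by apply: (@nd_inst _ _ _ (Neg A)); [rewrite /= fA|apply: nd_hd].
Qed.

Lemma nd_refl G t : G ⊢[T] Eq t t.
Proof. exact/nd_proves/pr_refl. Qed.

Lemma nd_sym G t u : G ⊢[T] Eq t u -> G ⊢[T] Eq u t.
Proof.
move=> tu; apply: nd_mp (nd_refl _ t).
by apply: nd_mp tu; apply/nd_proves/pr_eucl.
Qed.

Lemma nd_trans G t u v : G ⊢[T] Eq t u -> G ⊢[T] Eq u v -> G ⊢[T] Eq t v.
Proof.
move/nd_sym=> ut uv; apply: nd_mp uv.
by apply: nd_mp ut; apply/nd_proves/pr_eucl.
Qed.

Lemma nd_succ G t u : G ⊢[T] Eq t u -> G ⊢[T] Eq (Succ t) (Succ u).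
Proof. by apply: nd_mp; apply/nd_proves/pr_succ. Qed.

Lemma nd_add G t u t' u' :
  G ⊢[T] Eq t t' -> G ⊢[T] Eq u u' -> G ⊢[T] Eq (Add t u) (Add t' u').
Proof.
by move=> tt' uu'; apply: nd_mp uu'; apply: nd_mp tt'; apply/nd_proves/pr_add.
Qed.

Lemma nd_mul G t u t' u' :
  G ⊢[T] Eq t t' -> G ⊢[T] Eq u u' -> G ⊢[T] Eq (Mul t u) (Mul t' u').
Proof.
by move=> tt' uu'; apply: nd_mp uu'; apply: nd_mp tt'; apply/nd_proves/pr_mul.
Qed.

Lemma nd_tsubst G i s t :
  G ⊢[T] Eq (Var i) s -> G ⊢[T] Eq t (tsubst i s t).
Proof.
move=> is_; elim: t => /= [j||t|t ? u|t ? u]; [|exact: nd_refl|exact: nd_succ|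
  exact: nd_add|exact: nd_mul].
by case: eqP => [<-|_] //; apply: nd_refl.
Qed.

(** Leibniz's law. Both directions are proved together because implication is contravariant in its
    premise; closedness of [s] keeps other variables out of the equation, so that one may generalise
    under it. *)
Lemma nd_subst i s A : closed_term s ->
  [:: A; Eq (Var i) s] ⊢[T] subst i s A /\
  [:: subst i s A; Eq (Var i) s] ⊢[T] A.
Proof.
move=> cs; pose E := Eq (Var i) s.
have tE H t : [:: H; E] ⊢[T] Eq t (tsubst i s t).
  by apply: nd_tsubst; apply: nd_weak (nd_hd _ _).
elim: A => /= [|t u|A [A1 A2] B [B1 B2]|j A [A1 A2]].
- by split; apply: nd_hd.
- split.
    by apply: nd_trans (nd_sym (tE _ t)) (nd_trans (nd_hd _ _) (tE _ u)).
  by apply: nd_trans (tE _ t) (nd_trans (nd_hd _ _) (nd_sym (tE _ u))).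
- split.
    change ([:: subst i s A; Imp A B; E] ⊢[T] subst i s B).
    apply: (@nd_mp _ B).
      exact: nd_weak (nd_weak _ (nd_imp B1)).
    apply: (@nd_mp _ A); first exact: nd_weak (nd_hd _ _).
    apply: (@nd_mp _ (subst i s A)); last exact: nd_hd.
    exact: nd_weak (nd_weak _ (nd_imp A2)).
  change ([:: A; Imp (subst i s A) (subst i s B); E] ⊢[T] B).
  apply: (@nd_mp _ (subst i s B)).
    exact: nd_weak (nd_weak _ (nd_imp B2)).
  apply: (@nd_mp _ (subst i s A)); first exact: nd_weak (nd_hd _ _).
  apply: (@nd_mp _ A); last exact: nd_hd.
  exact: nd_weak (nd_weak _ (nd_imp A1)).
- case: eqP => [->|/eqP ij]; first by split; apply: nd_hd.
  have nE : ~~ free j E by rewrite /= negb_or eq_sym ij cs.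
  have step B C : [:: B; E] ⊢[T] C -> [:: All j B; E] ⊢[T] All j C.
    move=> HB; have HB' : [:: E] ⊢[T] All j (Imp B C).
      by apply: nd_gen (nd_imp HB); rewrite /= nE.
    apply: nd_gen; first by rewrite /= eqxx nE.
    apply: (@nd_mp _ B).
      have := @nd_inst _ j (Var j) (Imp B C) (free_for_var _ _)
        (nd_weak (All j B) HB').
      by rewrite subst_var.
    by have := @nd_inst _ j (Var j) B (free_for_var _ _) (nd_hd _ [:: E]);
      rewrite subst_var.
  by split; apply: step.
Qed.

(** As [A] is a sentence, no generalisation in the derivation concerns a free variable of the
    antecedent. *)
Lemma deduction A B : sentence A -> proves (extend T A) B -> [:: A] ⊢[T] B.
Proof.
move=> sA; elim=> [C [TC| ->]|C D _ CD _ HA|i C _ HA|C D|C D E|C|i t C fC|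
  i C D nC|t|t u v|t u|t u t' u'|t u t' u'].
- by apply: nd_proves; apply: pr_ax.
- exact: nd_hd.
- exact: nd_mp CD HA.
- by apply: nd_gen HA; rewrite /= sA.
- exact/nd_proves/pr_k.
- exact/nd_proves/pr_s.
- exact/nd_proves/pr_dn.
- exact/nd_proves/pr_inst.
- exact/nd_proves/pr_dist.
- exact/nd_proves/pr_refl.
- exact/nd_proves/pr_eucl.
- exact/nd_proves/pr_succ.
- exact/nd_proves/pr_add.
- exact/nd_proves/pr_mul.
Qed.

End NaturalDeduction.

(** * Arithmetic in Q *)

Fixpoint oneof (v : term) (N : nat) : form :=
  if N is M.+1 then Or (oneof v M) (Eq v (num N)) else Eq v (num 0).

Lemma subst_oneof i s v N : subst i s (oneof v N) = oneof (tsubst i s v) N.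
Proof.
by elim: N => //= N ->; rewrite tsubst_num.
Qed.

Lemma free_for_oneof i s v N : free_for i s (oneof v N).
Proof. by elim: N => //= N ->. Qed.

Lemma free_oneof i v N : free i (oneof v N) -> occurs i v.
Proof.
elim: N => /= [|N IH]; first by rewrite orbF.
by rewrite orbF (negbTE (closed_num N i)) orbF => /orP[/IH|].
Qed.

Section Arithmetic.

Context (T : form -> Prop) (TQ : extends T Q).
Implicit Types (A C : form) (G : seq form) (t u v : term).

(** Putting [t] under the quantifier on x' must not cause capture; this is the source of the
    conditions [~~ occurs 1 t] in what follows. *)
Lemma nd_inst2 G t u A :
  G ⊢[T] All 0 (All 1 A) ->
  ~~ occurs 1 t -> free_for 0 t A -> free_for 1 u (subst 0 t A) ->
  G ⊢[T] subst 1 u (subst 0 t A).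
Proof.
move=> GA nt ft fu; apply: nd_inst => //.
by apply: (@nd_inst _ _ 0 t (All 1 A)) => //=; rewrite ft nt.
Qed.

Lemma nd_succ_neq0 G t : G ⊢[T] Neg (Eq (Succ t) Zero).
Proof.
exact: (@nd_inst _ _ 0 t (Neg (Eq (Succ x0) Zero)) isT (nd_proves _ (TQ Q1))).
Qed.

Lemma nd_succ_inj G t u : ~~ occurs 1 t ->
  G ⊢[T] Eq (Succ t) (Succ u) -> G ⊢[T] Eq t u.
Proof.
move=> nt; apply: nd_mp.
have := nd_inst2 (u := u) (nd_proves G (TQ Q2)) nt isT isT.
by rewrite /= tsubst_id.
Qed.

Lemma nd_zero_or_succ G :
  G ⊢[T] Or (Eq x0 Zero) (Ex 1 (Eq x0 (Succ x1))).
Proof. exact: (nd_inst (t := Var 0) _ (nd_proves _ (TQ Q3))). Qed.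

Lemma nd_add0 G t : G ⊢[T] Eq (Add t Zero) t.
Proof.
exact: (@nd_inst _ _ 0 t (Eq (Add x0 Zero) x0) isT (nd_proves _ (TQ Q4))).
Qed.

Lemma nd_addS G t u : ~~ occurs 1 t ->
  G ⊢[T] Eq (Add t (Succ u)) (Succ (Add t u)).
Proof.
move=> nt; have := nd_inst2 (u := u) (nd_proves G (TQ Q5)) nt isT isT.
by rewrite /= tsubst_id.
Qed.

Lemma nd_mul0 G t : G ⊢[T] Eq (Mul t Zero) Zero.
Proof.
exact: (@nd_inst _ _ 0 t (Eq (Mul x0 Zero) Zero) isT (nd_proves _ (TQ Q6))).
Qed.

Lemma nd_mulS G t u : ~~ occurs 1 t ->
  G ⊢[T] Eq (Mul t (Succ u)) (Add (Mul t u) t).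
Proof.
move=> nt; have := nd_inst2 (u := u) (nd_proves G (TQ Q7)) nt isT isT.
by rewrite /= tsubst_id.
Qed.

Lemma nd_add_num G m n : G ⊢[T] Eq (Add (num m) (num n)) (num (m + n)).
Proof.
elim: n => [|n IH]; first by rewrite addn0; apply: nd_add0.
rewrite addnS /=; apply: nd_trans (nd_succ IH).
exact/nd_addS/closed_num.
Qed.

Lemma nd_mul_num G m n : G ⊢[T] Eq (Mul (num m) (num n)) (num (m * n)).
Proof.
elim: n => [|n IH]; first by rewrite muln0; apply: nd_mul0.
rewrite mulnSr; apply: nd_trans (nd_mulS _ _ (closed_num m 1)) _.
exact: nd_trans (nd_add IH (nd_refl _ _ _)) (nd_add_num _ _ _).
Qed.

Lemma oneof_intro G v n N :
  n <= N -> G ⊢[T] Eq v (num n) -> G ⊢[T] oneof v N.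
Proof.
elim: N => /= [|N IH]; first by rewrite leqn0 => /eqP->.
rewrite leq_eqVlt => /orP[/eqP-> /nd_or_intror|/IH nN /nN]; first exact.
exact: nd_or_introl.
Qed.

Lemma oneof_elim G v C N :
  (forall n, n <= N -> G ⊢[T] Imp (Eq v (num n)) C) ->
  G ⊢[T] oneof v N -> G ⊢[T] C.
Proof.
elim: N G => /= [|N IH] G vC; first by apply: nd_mp; apply: (vC 0).
move/nd_or_elim; apply; last exact: (vC N.+1 (leqnn _)).
apply: (IH _ _ (nd_hd _ _ _)) => n nN.
by apply: nd_weak; apply: vC; apply: leqW.
Qed.

(** The induction on [N] takes place outside the theory. In Q, x is 0 or the successor of some x';
    in the latter case z + x = 0 is absurd, and z + x = N + 1 gives z + x' = N. The variable x''
    plays z, since x and x' are taken by [Q3]. *)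
Lemma add_eq_num N :
  [:: Eq (Add (Var 2) x0) (num N)] ⊢[T] oneof x0 N.
Proof.
elim: N => [|N IH]; set E := Eq _ _; apply: nd_or_elim (nd_zero_or_succ _) _ _;
  try exact: (@oneof_intro _ _ 0 _ isT (nd_hd _ _ _)).
  apply: nd_ex_elim _ (nd_hd _ _ _) _ => //.
  apply: nd_botE; apply: nd_mp (nd_succ_neq0 _ (Add (Var 2) x1)) _.
  apply: nd_trans (nd_weak _ (nd_weak _ (nd_hd _ _ _))).
  apply: nd_trans (nd_add (nd_refl _ _ _) (nd_sym (nd_hd _ _ _))).
  by apply: nd_sym; apply: nd_addS.
apply: nd_ex_elim _ (nd_hd _ _ _) _.
  rewrite /= !orbF closed_num !andbT.
  by apply/norP; split; [apply/negP => /free_oneof|apply: closed_num].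
set H := Eq x0 _; set G := [:: H; _; E].
have e : G ⊢[T] Eq (num N) (Add (Var 2) x1).
  apply: nd_succ_inj (closed_num N 1) _.
  apply: nd_trans (nd_addS _ _ (isT : ~~ occurs 1 (Var 2))).
  apply: nd_sym; apply: nd_trans (nd_weak _ (nd_weak _ (nd_hd _ _ _))).
  exact: nd_add (nd_refl _ _ _) (nd_sym (nd_hd _ _ _)).
(* The induction hypothesis speaks of x, so it is generalised over x and instantiated at x'. *)
have : G ⊢[T] oneof x1 N.
  apply: nd_mp (nd_sym e); have := nd_gen (i := 0) (isT : all _ [::]) (nd_imp IH).
  move/nd_inst => /(_ x1); rewrite /= free_for_oneof => /(_ isT).
  rewrite subst_oneof /= tsubst_num; exact: nd_proves.
apply: oneof_elim => n nN; apply: (nd_imp (A := Eq x1 (num n))).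
apply: (@oneof_intro _ _ n.+1) => //.
exact: nd_trans (nd_weak _ (nd_hd _ _ _)) (nd_succ (nd_hd _ _ _)).
Qed.

Lemma nd_bounded i z N C : z != 0 ->
  (forall n, n <= N -> [::] ⊢[T] Imp (Eq (Var i) (num n)) C) ->
  [::] ⊢[T] Imp (Eq (Add (Var z) (Var i)) (num N)) C.
Proof.
move=> z0 iC.
(* The variables of [add_eq_num] are renamed in turn, x'' to [z] and then x to [i]; [z0] keeps the
   second renaming from touching [z]. *)
have := nd_gen (i := 2) (isT : all _ [::]) (nd_imp (add_eq_num N)).
move/nd_inst => /(_ (Var z)); rewrite /= free_for_oneof => /(_ isT).
rewrite subst_oneof /= tsubst_num.
move/(nd_gen (i := 0) (isT : all _ [::])).
move/nd_inst => /(_ (Var i)); rewrite /= free_for_oneof => /(_ isT).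
rewrite subst_oneof /= tsubst_num eq_sym (negbTE z0) => zN.
apply: (nd_imp (A := Eq (Add (Var z) (Var i)) (num N))).
apply: (oneof_elim (v := Var i) (N := N)) => [n /iC|]; last exact: zN.
exact: nd_weak.
Qed.

End Arithmetic.

(** * Provability of true bounded formulas *)

Definition tupd (r : nat -> term) (i : nat) (t : term) : nat -> term :=
  fun j => if j == i then t else r j.

Fixpoint tinst (r : nat -> term) (t : term) : term :=
  match t with
  | Var i => r i
  | Zero => Zero
  | Succ u => Succ (tinst r u)
  | Add u v => Add (tinst r u) (tinst r v)
  | Mul u v => Mul (tinst r u) (tinst r v)
  end.

(** Simultaneous substitution without renaming: in use, [r] yields numerals except at bound
    variables, which stay themselves. *)
Fixpoint finst (r : nat -> term) (A : form) : form :=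
  match A with
  | Bot => Bot
  | Eq t u => Eq (tinst r t) (tinst r u)
  | Imp B C => Imp (finst r B) (finst r C)
  | All i B => All i (finst (tupd r i (Var i)) B)
  end.

Lemma eq_tinst r r' t :
  (forall i, occurs i t -> r i = r' i) -> tinst r t = tinst r' t.
Proof.
elim: t => //= [i|t IHt|t IHt u IHu|t IHt u IHu] rr'.
- exact: rr'.
- by rewrite IHt.
- by rewrite IHt ?IHu // => i it; rewrite rr' // it ?orbT.
- by rewrite IHt ?IHu // => i it; rewrite rr' // it ?orbT.
Qed.

Lemma eq_finst r r' A : r =1 r' -> finst r A = finst r' A.
Proof.
elim: A r r' => //= [t u|A IHA B IHB|i A IHA] r r' rr'.
- by rewrite (eq_tinst (r' := r')) ?(eq_tinst (t := u) (r' := r')).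
- by rewrite (IHA _ r') ?(IHB _ r').
- by rewrite (IHA _ (tupd r' i (Var i))) // => j; rewrite /tupd rr'.
Qed.

Lemma subst_tinst r i s t : (forall j, j != i -> ~~ occurs i (r j)) ->
  tsubst i s (tinst (tupd r i (Var i)) t) = tinst (tupd r i s) t.
Proof.
move=> ri; elim: t => //= [j|t ->|t -> u ->|t -> u ->] //.
rewrite /tupd; case: eqP => [_|/eqP ji] /=; first by rewrite eqxx.
exact/tsubst_id/ri.
Qed.

(** The other terms of [r] do not contain x_i, so the substitution reaches only what came from x_i
    itself. *)
Lemma subst_finst r i s A : (forall j, j != i -> ~~ occurs i (r j)) ->
  subst i s (finst (tupd r i (Var i)) A) = finst (tupd r i s) A.
Proof.
elim: A r => //= [t u|A IHA B IHB|j A IHA] r ri.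
- by rewrite !subst_tinst.
- by rewrite IHA ?IHB.
- case: eqP => [<-|/eqP ij]; congr All.
    by apply: eq_finst => k; rewrite /tupd; case: eqP.
  rewrite (eq_finst (r' := tupd (tupd r j (Var j)) i (Var i))).
    rewrite IHA => [|k ki].
      apply: eq_finst => k; rewrite /tupd; case: eqP => // ->.
      by rewrite (negbTE ij).
    by rewrite /tupd; case: eqP => _ /=; rewrite ?ij ?ri.
  move=> k; rewrite /tupd; case: eqP => // ->.
  by rewrite eq_sym (negbTE ij).
Qed.

Lemma free_finst r j A :
  (forall k, ~~ occurs j (r k)) -> ~~ free j (finst r A).
Proof.
have free_tinst (r' : nat -> term) t :
    (forall k, ~~ occurs j (r' k)) -> ~~ occurs j (tinst r' t).
  by move=> rj; elim: t => //= t IHt u IHu; rewrite negb_or IHt.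
elim: A r => //= [t u|A IHA B IHB|k A IHA] r rj.
- by rewrite negb_or !free_tinst.
- by rewrite negb_or IHA ?IHB.
- case: eqP => //= /eqP jk; apply: IHA => l; rewrite /tupd.
  by case: eqP.
Qed.

(** Here [n] is the level of an [lform]: its binders use indices from [n] on, so updates at them
    leave the value of such a term unchanged. *)
Fixpoint below (n : nat) (t : term) : bool :=
  match t with
  | Var i => i < n
  | Zero => true
  | Succ u => below n u
  | Add u v | Mul u v => below n u && below n v
  end.

Lemma below_num n m : below n (num m).
Proof. by elim: m. Qed.

Lemma belowW m n t : m <= n -> below m t -> below n t.
Proof.
move=> mn; elim: t => //= [i im|t IHt u IHu|t IHt u IHu].
- exact: leq_trans mn.
- by case/andP => /IHt-> /IHu->.
- by case/andP => /IHt-> /IHu->.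
Qed.

Lemma below_occurs n i t : below n t -> n <= i -> ~~ occurs i t.
Proof.
move=> + ni; elim: t => //= [j jn|t IHt u IHu|t IHt u IHu].
- by apply/eqP => ij; rewrite -ij ltnNge ni in jn.
- by case/andP => /IHt/negbTE-> /IHu->.
- by case/andP => /IHt/negbTE-> /IHu->.
Qed.

Definition agree (n : nat) (e e' : nat -> nat) : Prop :=
  forall i, i < n -> e' i = e i.

Lemma agree_upd n e i k : n <= i -> agree n e (upd e i k).
Proof.
move=> ni j jn; rewrite /upd; case: eqP => // ji.
by rewrite -ji leqNgt jn in ni.
Qed.

Lemma eval_agree n e e' t : agree n e e' -> below n t -> eval e' t = eval e t.
Proof.
move=> ee'; elim: t => //= [t IHt|t IHt u IHu|t IHt u IHu].
- by move/IHt->.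
- by case/andP => /IHt-> /IHu->.
- by case/andP => /IHt-> /IHu->.
Qed.

Lemma eval_upd e n k t : below n t -> eval (upd e n k) t = eval e t.
Proof. exact/eval_agree/agree_upd. Qed.

Lemma eval_num e n : eval e (num n) = n.
Proof. by elim: n => //= n ->. Qed.

Lemma eval_pair e t u : eval e (pair t u) = op (eval e t) (eval e u).
Proof. by []. Qed.

Lemma below_pair n t u : below n (pair t u) = below n t && below n u.
Proof. by rewrite /=; case: (below n t); case: (below n u). Qed.

(** The analogue of [sat] with provability of the numeral instance in place of truth; quantifiers
    are then handled by updating [e]. *)
Definition holds (T : form -> Prop) (e : nat -> nat) (A : form) : Prop :=
  proves T (finst (fun i => num (e i)) A).

Section SigmaCompleteness.

Context (T : form -> Prop) (TQ : extends T Q).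
Implicit Types (A B : form) (e : nat -> nat) (t u : term).

Lemma proves_eval e t :
  [::] ⊢[T] Eq (tinst (fun i => num (e i)) t) (num (eval e t)).
Proof.
elim: t => /= [i||t IHt|t IHt u IHu|t IHt u IHu].
- exact: nd_refl.
- exact: nd_refl.
- exact: nd_succ.
- exact: nd_trans (nd_add IHt IHu) (nd_add_num TQ _ _ _).
- exact: nd_trans (nd_mul IHt IHu) (nd_mul_num TQ _ _ _).
Qed.

Lemma holds_eq e t u n : eval e t = eval e u -> holds T e (aeq t u n).
Proof.
move=> tu; apply: nd_trans (proves_eval e t) _; rewrite tu.
exact/nd_sym/proves_eval.
Qed.

Lemma holds_and e (A B : lform) n :
  holds T e (A n) -> holds T e (B n) -> holds T e (aand A B n).
Proof. exact: (@nd_and_intro T [::]). Qed.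

Lemma holds_anyof k e (s : seq lform) n :
  holds T e (nth (fun _ => Bot) s k n) -> holds T e (anyof s n).
Proof.
elim: s k => [|A s IH] [|k] //=.
  exact: (@nd_or_introl T [::]).
by move/IH; apply: (@nd_or_intror T [::]).
Qed.

Lemma finst_upd e n k A :
  finst (fun j => num (upd e n k j)) A =
  subst n (num k) (finst (tupd (fun j => num (e j)) n (Var n)) A).
Proof.
rewrite subst_finst => [|j _]; last exact: closed_num.
by apply: eq_finst => j; rewrite /upd /tupd; case: eqP.
Qed.

Lemma holds_ex k e (F : term -> lform) n :
  holds T (upd e n k) (F (Var n) n.+1) -> holds T e (aex F n).
Proof.
rewrite /holds finst_upd => kF.
apply: (@nd_ex_intro T [::] n (num k)) => //.
exact/free_for_closed/closed_num.
Qed.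

Lemma holds_le e t u n : below n t -> below n u ->
  eval e t <= eval e u -> holds T e (ale t u n).
Proof.
move=> nt nu tu; apply: (@holds_ex (eval e u - eval e t)).
by apply: holds_eq; rewrite /= !eval_upd // {1}/upd eqxx subnK.
Qed.

Lemma holds_lt e t u n : below n t -> below n u ->
  eval e t < eval e u -> holds T e (alt t u n).
Proof. exact: (@holds_le e (Succ t)). Qed.

Lemma holds_exle k e b (F : term -> lform) n : below n b -> k <= eval e b ->
  holds T (upd e n k) (F (Var n) n.+1) -> holds T e (aexle b F n).
Proof.
move=> nb kb kF; apply: (@holds_ex k); apply: holds_and => //.
apply: holds_le => /=; rewrite ?ltnSn ?(belowW (leqnSn n)) //.
by rewrite eval_upd // /upd eqxx.
Qed.

(** In Q, a number bounded by a numeral is one of finitely many numerals, and in each case Leibniz's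
    law carries the instance at the numeral over to the variable. *)
Lemma holds_allle e b (F : term -> lform) n : below n b ->
  (forall k, k <= eval e b -> holds T (upd e n k) (F (Var n) n.+1)) ->
  holds T e (aallle b F n).
Proof.
move=> nb kF; set r := fun j => num (e j); pose r1 := tupd r n (Var n).
set A := F (Var n) n.+1 in kF; pose b' := tinst r b.
change ([::] ⊢[T] finst r
  (All n (Imp (Ex n.+1 (Eq (Add (Var n.+1) (Var n)) b)) A))).
(* The variables of [b] lie below [n], so the two binders do not affect its instantiation. *)
have -> : finst r (All n (Imp (Ex n.+1 (Eq (Add (Var n.+1) (Var n)) b)) A)) =
    All n (Imp (Ex n.+1 (Eq (Add (Var n.+1) (Var n)) b')) (finst r1 A)).
  rewrite /= {1 2 3 4}/tupd eqxx (ltn_eqF (ltnSn n)) eqxx.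
  rewrite (eq_tinst (r' := r)) // => i ib; rewrite /tupd.
  have := contraL (below_occurs (i := i) nb) ib; rewrite -ltnNge => ni.
  by rewrite !ltn_eqF // (ltn_trans ni).
apply: nd_gen => //.
change ([:: Ex n.+1 (Eq (Add (Var n.+1) (Var n)) b')] ⊢[T] finst r1 A).
have nA : ~~ free n.+1 (finst r1 A).
  apply: free_finst => k; rewrite /r1 /tupd.
  case: eqP => _; last exact: closed_num.
  by rewrite /= gtn_eqF.
apply: nd_ex_elim _ (nd_hd _ _ _) _.
  by rewrite /= nA eqxx.
(* The term [b'] is replaced by the numeral of its value, as [nd_bounded] requires. *)
apply: (@nd_mp _ _ (Eq (Add (Var n.+1) (Var n)) (num (eval e b)))).
  do 2!apply: nd_weak; apply: nd_bounded => // k /kF.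
  rewrite /holds finst_upd -/r -/r1 => kA.
  apply: (nd_imp (A := Eq (Var n) (num k))).
  have [_ kA'] := nd_subst T n (finst r1 A) (closed_num k).
  exact: nd_mp (nd_imp kA') (nd_proves _ kA).
apply: nd_trans (nd_hd _ _ _) _; do 2!apply: nd_weak; exact: proves_eval.
Qed.

Lemma holds_beta e b a i x n :
  [&& below n b, below n a, below n i & below n x] ->
  eval e x = eval e b %% ((eval e i).+1 * eval e a).+1 ->
  holds T e (beta b a i x n).
Proof.
case/and4P => nb na ni nx ex; apply: holds_and.
  by apply: holds_lt; rewrite /= ?ni ?na // ex ltn_mod.
apply: (@holds_exle (eval e b %/ ((eval e i).+1 * eval e a).+1)) => //.
  exact: leq_div.
apply: holds_eq; rewrite /= !eval_upd // /upd eqxx ex.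
by rewrite -divn_eq.
Qed.

End SigmaCompleteness.

(** * The beta function and traces *)

(** The Chinese remainder theorem for several moduli: each new modulus is coprime to the product of
    the earlier ones. *)
Lemma chinese_seq (m r : nat -> nat) k :
  (forall i j, i < j < k -> coprime (m i) (m j)) ->
  exists b, forall i, i < k -> b = r i %[mod m i].
Proof.
elim: k => [|k IH] co; first by exists 0.
have [|b bk] := IH; first by move=> i j /andP[ij jk]; apply: co; rewrite ij leqW.
have cok : coprime (\prod_(i < k) m i) (m k).
  by elim/big_ind: _ => [|x y cx cy|i _]; rewrite ?coprime1n ?coprimeMl ?cx //
    co ?ltn_ord /=.
exists (chinese (\prod_(i < k) m i) (m k) b (r k)) => i.
rewrite ltnS leq_eqVlt => /orP[/eqP->|ik]; first exact: chinese_modr.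
rewrite -bk //; have mi : m i %| \prod_(i < k) m i.
  by rewrite (bigD1 (Ordinal ik)) //= dvdn_mulr.
by rewrite -(modn_dvdm _ mi) chinese_modl // modn_dvdm.
Qed.

Lemma beta_function (s : seq nat) : exists a b,
  forall i, i < size s -> nth 0 s i = b %% (i.+1 * a).+1.
Proof.
(* The factorial is divisible by every difference of indices, which makes the moduli coprime, and it
   is at least every entry, so that each entry is smaller than its modulus. *)
pose M := maxn (size s) (\max_(x <- s) x); pose a := M`!.
pose m i := (i.+1 * a).+1; exists a.
have [|b bs] := @chinese_seq m (nth 0 s) (size s).
  move=> i j /andP[ij js]; rewrite /coprime -dvdn1; set d := gcdn _ _.
  (* A common divisor of the two moduli divides a combination of them in which [a] cancels, namely j
     - i; hence it divides [a], and so 1. *)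
  have da : d %| a.
    apply: dvdn_trans (_ : j - i %| a); last first.
      apply: dvdn_fact; rewrite subn_gt0 ij /= leq_max.
      by rewrite (leq_trans (leq_subr _ _)) // ltnW.
    have <- : j.+1 * m i - i.+1 * m j = j - i.
      by rewrite /m !mulnS [in X in _ - X]mulnCA subnDr subSS.
    by rewrite dvdn_sub ?dvdn_mull ?dvdn_gcdl ?dvdn_gcdr.
  by have := dvdn_gcdl (m i) (m j); rewrite -/d /m -addn1 dvdn_addr // dvdn_mull.
exists b => i is_; rewrite bs // modn_small // ltnS.
apply: leq_trans (leq_pmull _ _) => //; apply: leq_trans (fact_geq _).
by rewrite leq_max (@leq_bigmax_seq _ _ xpredT id) ?orbT // mem_nth.
Qed.

Lemma upd_same e i k : upd e i k i = k.
Proof. by rewrite /upd eqxx. Qed.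

Lemma upd_lt e i j k : i < j -> upd e j k i = e i.
Proof. by move=> ij; rewrite /upd ltn_eqF. Qed.

(** The beta code of [s] also bounds its entries, a remainder being at most the dividend. The
    variables from [n] to [n.+4] are b, a, k, i, y of [trace]. The environment [e'] is the one in
    which the rule is evaluated, and [e''] one reached under further binders of the rule, where
    [prev] is called. *)
Lemma holds_trace (T : form -> Prop) (TQ : extends T Q)
    e (R : rule) x n (s : seq nat) :
  below n x -> 0 < size s -> eval e x = nth 0 s (size s).-1 ->
  (forall i e' (prev : term -> lform),
    i < size s -> agree n e e' -> e' n.+4 = nth 0 s i ->
    (forall j, j < size s -> nth 0 s j <= e' n) ->
    (forall j e'' m z, j < i -> n.+4 < m -> agree n.+4.+1 e' e'' ->
      below m z -> eval e'' z = nth 0 s j -> holds T e'' (prev z m)) ->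
    holds T e' (R (Var n) prev (Var n.+4) n.+4.+1)) ->
  holds T e (trace R x n).
Proof.
move=> nx s0 ex step; have [a [b ab]] := beta_function s.
have nthb j : j < size s -> nth 0 s j <= b.
  by move=> js; rewrite ab // leq_mod.
set K := (size s).-1 in ex.
apply: (holds_ex (k := b)); apply: (holds_ex (k := a)).
apply: (holds_ex (k := K)); set e3 := upd _ n.+2 K.
have [e3n e3a e3k] : [/\ e3 n = b, e3 n.+1 = a & e3 n.+2 = K].
  by rewrite /e3 upd_same !(upd_same, upd_lt) //; lia.
have ee3 : agree n e e3 by move=> j jn; rewrite /e3 !upd_lt //; lia.
clearbody e3.
apply: holds_and.
  apply: holds_beta => //=; first by rewrite (belowW _ nx); lia.
  by rewrite (eval_agree ee3 nx) e3n e3a e3k ex ab // /K; lia.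
apply: holds_allle => //=.
move=> i; rewrite e3k => iK; have is_ : i < size s by lia.
apply: (holds_exle TQ (k := nth 0 s i)) => /=; first by lia.
  by rewrite upd_lt ?e3n ?nthb //; lia.
set e5 := upd _ n.+4 _.
have [e5n e5a e5i e5y] :
    [/\ e5 n = b, e5 n.+1 = a, e5 n.+3 = i & e5 n.+4 = nth 0 s i].
  by rewrite /e5 !(upd_same, upd_lt) //; lia.
have ee5 : agree n e e5.
  by move=> j jn; rewrite /e5 !upd_lt ?ee3 //; lia.
clearbody e5.
apply: holds_and.
  apply: holds_beta => //=; first by lia.
  by rewrite e5n e5a e5i e5y ab.
apply: (step i e5) => // [j /nthb|j e'' m z ji nm ee'' mz ez].
  by rewrite e5n.
(* It remains to show that [prev] holds of an earlier entry; the witness is its index [j]. *)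
have e''i : e'' n.+3 = i by rewrite ee'' //; lia.
apply: (holds_exle TQ (k := j)) => /=; first by lia.
  by rewrite e''i; lia.
apply: holds_and.
  apply: holds_lt => //=; try lia.
  by rewrite upd_same upd_lt ?e''i //; lia.
apply: holds_beta => //=.
  by rewrite (belowW _ mz) //; lia.
rewrite eval_upd // upd_same !upd_lt ?ee'' ?e5n ?e5a ?ez ?ab //; lia.
Qed.

(** * Judgements about concrete codes *)

(** Components do not exceed the pair, so a bound on the entries of a trace also bounds the
    witnesses taken from them. *)
Lemma op_gel a b : a <= op a b.
Proof. by rewrite /op -addSn leq_addl. Qed.

Lemma op_ger a b : b <= op a b.
Proof. by rewrite /op; nia. Qed.

(* Codes are huge in unary, so conversion must not unfold [op]. *)
Local Opaque op.

Section ConcreteTraces.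

Context (T : form -> Prop) (TQ : extends T Q).
Implicit Types (e : nat -> nat) (t : term).

(** As ⊥ is a leaf, the derivation has a single entry. *)
Lemma holds_alen_bot e x l n : below n x -> below n l ->
  eval e x = code Bot -> eval e l = 1 -> holds T e (alen x l n).
Proof.
move=> nx nl ex el.
apply: (holds_trace TQ (s := [:: op 1 (op (code Bot) 1)])) => //.
- by rewrite !below_pair below_num nx.
- by rewrite !eval_pair eval_num ex el.
(* Counting from 0, clause 5 of [len_rule] is the one for [qbot]. *)
move=> [|//] e' prev _ _ e'y _ _; apply: (holds_anyof (k := 5)).
by apply: holds_eq => //; rewrite !eval_pair !eval_num -[RHS]e'y.
Qed.

Lemma holds_collapse_bot e f x p n :
  below n f -> below n x -> below n p ->
  eval e x = code Bot -> eval e p = code Bot ->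
  holds T e (trace collapse_rule (jcollapse f Zero x p) n).
Proof.
move=> nf nx np ex ep.
pose v := op 6 (op (op (eval e f) 0) (op (code Bot) (code Bot))).
apply: (holds_trace TQ (s := [:: v])) => //.
- by rewrite !below_pair below_num nf nx.
- by rewrite !eval_pair eval_num ex ep.
move=> [|//] e' prev _ _ e'y /(_ 0 isT) /= sb _.
(* Six clauses precede those for [qleaves], in which [qbot] is second. *)
apply: (holds_anyof (k := 7)).
apply: (holds_exle TQ (k := eval e f)) => /=; first by lia.
  apply: leq_trans sb; apply: leq_trans (op_ger _ _).
  by apply: leq_trans (op_gel _ _); apply: op_gel.
(* The code of the empty list of bound variables is 0. *)
apply: (holds_exle TQ (k := 0)) => //; first by rewrite /=; lia.
apply: holds_eq => //; rewrite !eval_pair !eval_num /=.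
by rewrite !(upd_same, upd_lt) ?e'y //; lia.
Qed.

(** The derivation lists the judgements for 0, ..., k, each obtained from the one before; 4 is the
    tag of [jnum]. *)
Lemma holds_num e y c n k : below n y -> below n c ->
  eval e y = k -> eval e c = tcode (num k) ->
  holds T e (trace num_rule (jnum y c) n).
Proof.
move=> ny nc ey ec; pose d i := op 4 (op i (tcode (num i))).
apply: (holds_trace TQ (s := mkseq d k.+1)); rewrite ?size_mkseq //.
- by rewrite !below_pair below_num ny.
- by rewrite nth_mkseq // !eval_pair eval_num ey ec.
move=> [|i] e' prev ik _; rewrite nth_mkseq // => e'y sb prevP.
  apply: (holds_anyof (k := 0)).
  by apply: holds_eq => //; rewrite !eval_pair !eval_num -[RHS]e'y.
have := sb i (ltnW ik); rewrite nth_mkseq ?(ltnW ik) // => ib.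
apply: (holds_anyof (k := 1)).
apply: (holds_exle TQ (k := i)) => /=; first by lia.
  by apply: leq_trans ib; apply: leq_trans (op_ger _ _); apply: op_gel.
apply: (holds_exle TQ (k := tcode (num i))) => /=; first by lia.
  rewrite upd_lt; last by lia.
  by apply: leq_trans ib; apply: leq_trans (op_ger _ _); apply: op_ger.
apply: holds_and.
  apply: (prevP i) => //; first by lia.
  - by move=> j jn; rewrite !upd_lt //; lia.
  - by rewrite !below_pair below_num /=; lia.
  - rewrite !eval_pair eval_num /=.
    by rewrite !(upd_same, upd_lt) ?nth_mkseq //; lia.
apply: holds_eq => //; rewrite !eval_pair !eval_num /=.
by rewrite !(upd_same, upd_lt) ?e'y //; lia.
Qed.

Lemma holds_aD_bot e x y z n : below n x -> below n y -> below n z ->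
  eval e x = code Bot -> eval e z = code (diag Bot (eval e y)) ->
  holds T e (aD x y z n).
Proof.
move=> nx ny nz ex ez.
(* The witnesses are the length of ⊥, the collapse of ⊥, which is ⊥ again, and the code of the
   numeral. *)
apply: (holds_ex (k := 1)); apply: (holds_ex (k := code Bot)).
apply: (holds_ex (k := tcode (num (eval e y)))).
set e3 := upd _ n.+2 _.
have [e3f e3p e3c] :
    [/\ e3 n = 1, e3 n.+1 = code Bot & e3 n.+2 = tcode (num (eval e y))].
  by rewrite /e3 !(upd_same, upd_lt) //; lia.
have ee3 : agree n e e3 by move=> j jn; rewrite /e3 !upd_lt //; lia.
clearbody e3.
have nW t : below n t -> below n.+3 t by apply: belowW; lia.
apply: holds_and.
  apply: holds_alen_bot => //=;
    first [exact: nW|lia|by rewrite (eval_agree ee3)].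
apply: holds_and.
  apply: holds_collapse_bot => //=;
    first [exact: nW|lia|by rewrite (eval_agree ee3)].
apply: holds_and.
  apply: holds_num => //=; first [exact: nW|by rewrite (eval_agree ee3)].
apply: holds_eq => //; rewrite (eval_agree ee3 nz) ez.
by rewrite !eval_pair !eval_num /= e3p e3c.
Qed.

End ConcreteTraces.

(** * The theorem *)

(** The formula [aPr delta t n] is [plug delta (aPr (Eq x0 x1) t n)], which
    reduces its closedness to a computation without the variable [delta]. *)
Fixpoint plug (d A : form) : form :=
  match A with
  | Eq x0 x1 => d
  | Imp B C => Imp (plug d B) (plug d C)
  | All i B => All i (plug d B)
  | _ => A
  end.

(** The placeholder [Eq x0 x1] has x and x' free, hence every variable that may be free in [d]. *)
Lemma free_plug d A i :
  (forall j, free j d -> j < 2) -> free i (plug d A) -> free i A.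
Proof.
move=> d2; elim: A => //= [t u|B IHB C IHC|j B IHB].
- by case: t u => [[|j]||t|t t'|t t'] [[|[|k]]||u|u u'|u u'] //= /d2;
    case: i => [|[]].
- by case/orP => [/IHB|/IHC] ->; rewrite ?orbT.
- by case/andP => -> /IHB.
Qed.

(** Unlike [occurs i] and [free i] for unknown [i], the tests [tscope] and [scope] evaluate on
    concrete terms and formulas. *)
Fixpoint tscope (G : seq nat) (t : term) : bool :=
  match t with
  | Var i => i \in G
  | Zero => true
  | Succ u => tscope G u
  | Add u v | Mul u v => tscope G u && tscope G v
  end.

Fixpoint scope (G : seq nat) (A : form) : bool :=
  match A with
  | Bot => true
  | Eq t u => tscope G t && tscope G u
  | Imp B C => scope G B && scope G C
  | All i B => scope (i :: G) B
  end.

Lemma tscope_occurs G t i : tscope G t -> occurs i t -> i \in G.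
Proof.
elim: t => //= [j jG /eqP->|t IHt u IHu|t IHt u IHu] //.
- by case/andP => /IHt Gt /IHu Gu /orP[].
- by case/andP => /IHt Gt /IHu Gu /orP[].
Qed.

Lemma scope_free G A i : scope G A -> free i A -> i \in G.
Proof.
elim: A G => //= [t u|B IHB C IHC|j B IHB] G.
- by case/andP => Gt Gu /orP[]; apply: tscope_occurs.
- by case/andP => GB GC /orP[/(IHB _ GB)|/(IHC _ GC)].
- by move/IHB=> jG /andP[ij /jG]; rewrite inE (negbTE ij).
Qed.

Section Definability.

Context (T : form -> Prop) (delta : form).
Context (TQ : extends T Q) (delta2 : forall i, free i delta -> i < 2).

Lemma free_delta i : 1 < i -> ~~ free i delta.
Proof. by move=> i1; apply/negP => /delta2; rewrite ltnNge i1. Qed.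

(** No binder of [aPr] at level 5 uses index 4, so the substitution computes through everything
    except the unknown [delta]. *)
Lemma subst_Pr s : subst 4 s (aPr delta (Var 4) 5) = Pr delta s.
Proof.
have -> : subst 4 s (aPr delta (Var 4) 5) = aPr (subst 4 s delta) s 5 by [].
by rewrite subst_id // free_delta.
Qed.

Lemma sentence_Pr s : closed_term s -> sentence (Pr delta s).
Proof.
move=> cs i; rewrite -subst_Pr; apply/negP => /(free_subst cs)/andP[i4].
have -> : aPr delta (Var 4) 5 = plug delta (aPr (Eq x0 x1) (Var 4) 5) by [].
move/(free_plug delta2)/(scope_free (G := [:: 4])).
by rewrite inE (negbTE i4) => /(_ isT).
Qed.

(** At level 3, [aDef] binds its formula by index 3, and both the length and the code of the
    diagonal sentence by index 4, in separate conjuncts. *)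
Lemma Def_intro z y s l d :
  closed_term z -> closed_term y -> closed_term s -> closed_term l ->
  closed_term d ->
  proves T (alen s l 5) -> proves T (alt l z 5) ->
  proves T (aD s y d 5) -> proves T (Pr delta d) ->
  proves T (Def delta z y).
Proof.
move=> cz cy cs cl cd Hsl Hlz Hsyd Hd.
apply: (@nd_ex_intro T [::] 3 s); first exact: free_for_closed.
change ([::] ⊢[T] And
  (Ex 4 (And (alen s (Var 4) 5) (alt (Var 4) (tsubst 3 s z) 5)))
  (Ex 4 (And (aD s (tsubst 3 s y) (Var 4) 5)
             (aPr (subst 3 s delta) (Var 4) 5)))).
rewrite !tsubst_id ?subst_id ?free_delta //.
apply: nd_and_intro.
  apply: (@nd_ex_intro T [::] 4 l); first exact: free_for_closed.
  change ([::] ⊢[T] And (alen (tsubst 4 l s) l 5) (alt l (tsubst 4 l z) 5)).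
  by rewrite !tsubst_id //; apply: nd_and_intro.
apply: (@nd_ex_intro T [::] 4 d); first exact: free_for_closed.
change ([::] ⊢[T] And (aD (tsubst 4 d s) (tsubst 4 d y) d 5)
                      (subst 4 d (aPr delta (Var 4) 5))).
by rewrite !tsubst_id // subst_Pr; apply: nd_and_intro.
Qed.

(** In [axiom_at], [delta] stands under a binder of x', where the substitution stops. *)
Lemma subst_Def z y : subst 1 z (Def delta x1 y) = Def delta z (tsubst 1 z y).
Proof. by []. Qed.

Lemma proves_alen_bot : proves T (alen (num (code Bot)) (num 1) 5).
Proof.
(* The numerals are presented as values of variables, to which the lemmas on [holds] apply. *)
pose e i := if i is 3 then code Bot else 1.
exact: (holds_alen_bot TQ (e := e) (x := Var 3) (l := Var 4) (n := 5)).
Qed.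

Lemma proves_alt m n k : m < n * k ->
  proves T (alt (num m) (Mul (num n) (num k)) 5).
Proof.
pose e i := match i with 2 => m | 3 => n | _ => k end.
exact: (holds_lt TQ (e := e) (t := Var 2) (u := Mul (Var 3) (Var 4)) (n := 5)).
Qed.

Lemma proves_aD_bot b :
  proves T (aD (num (code Bot)) (num b) (num (code (diag Bot b))) 5).
Proof.
(* Naming the codes makes conversion treat them as atoms. *)
move Ec: (code Bot) => c; move Ed: (code (diag Bot b)) => d.
pose e i := match i with 2 => b | 3 => c | _ => d end.
change (holds T e (aD (Var 3) (Var 2) (Var 4) 5)).
by apply: (holds_aD_bot TQ).
Qed.

(** [Berry] denies [Def] at x', but the equation for x' in [Boolos] and Leibniz's law transfer the
    provable [Def] to x'. *)
Lemma proves_neg_Boolos y : closed_term y ->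
  proves T (Def delta (Mul (num 5) (num (ell delta))) y) ->
  proves T (Neg (Boolos delta y)).
Proof.
move=> cy; set z := Mul _ _ => Dzy.
have cz : closed_term z by apply: closed_mul; apply: closed_num.
change ([:: Boolos delta y] ⊢[T] Bot).
apply: nd_mp (nd_hd _ _ _) _; apply: nd_proves; apply: pr_gen.
set A := And _ _; change ([:: A] ⊢[T] Bot).
apply: nd_mp (nd_andl (nd_andr (nd_hd _ _ _))) _.
have [_] := nd_subst T 1 (Def delta x1 y) cz.
rewrite subst_Def tsubst_id // => D1.
apply: nd_mp (nd_andl (nd_hd _ _ _)).
exact/nd_proves/(nd_mp (nd_imp D1))/nd_proves.
Qed.

End Definability.

Theorem theorem4p6 (T : form -> Prop) (delta : form)
  (T_sentences : forall A, T A -> sentence A)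
  (T_re : recursively_enumerable (codes T))
  (T_presented : presents delta T)
  (T_consistent : consistent T)
  (T_Q : extends T Q)
  (T_explosion : forall A : form,
     proves T (Imp (Pr delta (num (code Bot))) (Pr delta (num (code A)))))
  (T_Con : proves (extend T (Con delta)) Bot) :
  forall b : nat,
    proves T (Def delta (Mul (num 5) (num (ell delta))) (num b)) /\
    proves T (Neg (Boolos delta (num b))).
Proof.
have [_ delta2 _] := T_presented; move=> b.
have PrBot : proves T (Pr delta (num (code Bot))).
  (* The deduction theorem yields the negation of Con(T), which is the double negation of Pr(⊥). *)
  apply: pr_mp (pr_dn _ _) _; apply: deduction T_Con.
  by apply: sentence_neg; apply: sentence_Pr => //; apply: closed_num.
suff Db : proves T (Def delta (Mul (num 5) (num (ell delta))) (num b)).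
  by split=> //; apply: proves_neg_Boolos => //; apply: closed_num.
have cn := closed_num.
apply: (Def_intro delta2 (closed_mul (cn _) (cn _)) (cn b) (cn (code Bot)) (cn 1)
  (cn (code (diag Bot b)))).
- exact: proves_alen_bot.
(* The condition [1 < 5 * ell delta] holds by evaluation, the length of a formula being positive. *)
- exact: proves_alt.
- exact: proves_aD_bot.
- exact: pr_mp (T_explosion _) PrBot.
Qed.
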